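(* Any streaming certification scheme for $\mathrm{MaxClique}_{\leq 3}$ whose verifier uses $m$ bits of memory and whose certificates have $c$ bits satisfies $c+m=\Omega(n^2)$ on $n$-node graphs.
   Context: $\mathrm{MaxClique}_{\leq 3}$ is the decision problem (with fixed threshold $3$) taking as input a graph $G$ and asking whether the maximum clique of $G$ has size at most $3$. The $n$-node input graph on $[n]$ is given as a stream of edges in an arbitrary, possibly adversarial, order. A streaming certification scheme for a decision problem $P$ consists of a prover (a computationally unlimited function producing a certificate in $\{0,1\}^*$ depending only on the input graph, not on the edge order) and a verifier (a deterministic streaming algorithm with read-only access to the certificate that processes the stream and outputs accept or reject). Completeness: if $G$ satisfies $P$, some certificate makes the verifier accept for every edge order. Soundness: if $G$ does not satisfy $P$, the verifier rejects for every certificate and every edge order. $c$ is the certificate length and $m$ the verifier's memory excluding the certificate, as worst-case functions of $n$. *)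

(* Defs.v *)
From mathcomp Require Import all_boot.

Set Implicit Arguments.
Unset Strict Implicit.
Unset Printing Implicit Defensive.

Section Graphs.
Variable n : nat.

(* A simple graph on [n]; an edge is the 2-element set of its endpoints, so
   loops, parallel edges and orientations do not arise. *)
Record sgraph := SGraph {
  edges : {set {set 'I_n}};
  edges_card2 : [forall e in edges, #|e| == 2]
}.

Definition clique (G : sgraph) (K : {set 'I_n}) : bool :=
  [forall x in K, forall y in K, (x != y) ==> ([set x; y] \in edges G)].

Definition clique_number (G : sgraph) : nat :=
  \max_(K : {set 'I_n} | clique G K) #|K|.

(* Each edge occurs exactly once in a stream, in arbitrary order. *)
Definition edge_stream (G : sgraph) (s : seq {set 'I_n}) : bool :=
  perm_eq s (enum (edges G)).

End Graphs.

Definition graph_problem := forall n, sgraph n -> bool.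

Definition max_clique_le (k : nat) : graph_problem :=
  fun n G => clique_number G <= k.

Definition certificate := seq bool.

(* A deterministic streaming algorithm on n-node graphs with m bits of memory
   (not counting the certificate).  Having read-only access to the certificate
   means that the initial memory, each update and the final verdict may all
   depend on it. *)
Record verifier (n m : nat) := Verifier {
  init_mem : certificate -> m.-tuple bool;
  update   : certificate -> m.-tuple bool -> {set 'I_n} -> m.-tuple bool;
  verdict  : certificate -> m.-tuple bool -> bool
}.

Definition accepts n m (V : verifier n m) (w : certificate)
    (s : seq {set 'I_n}) : bool :=
  verdict V w (foldl (update V w) (init_mem V w) s).

(* The certificate length is bounded on the certificates the prover issues for
   graphs satisfying P; soundness is against certificates of every length. *)
Record certification_scheme (P : graph_problem) (c m : nat -> nat) := Scheme {
  prover : forall n, sgraph n -> certificate;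
  verif : forall n, verifier n (m n);
  prover_size : forall n (G : sgraph n), P n G -> size (prover G) <= c n;
  completeness : forall n (G : sgraph n) (s : seq {set 'I_n}),
    P n G -> edge_stream G s -> accepts (verif n) (prover G) s;
  soundness : forall n (G : sgraph n) (w : certificate) (s : seq {set 'I_n}),
    ~~ P n G -> edge_stream G s -> ~~ accepts (verif n) w s
}.

(* Main.v *)
(* Fooling set.  On vertices u_i, u'_i, w_j, w'_j (i, j < k) put the matchings
   u_i u'_i and w_j w'_j, all edges u_i w'_j and u'_i w_j, the edges u_i w_j for
   (i, j) in X and the edges u'_i w'_j for (i, j) in Y.  The only possible K_4
   are {u_i, u'_i, w_j, w'_j} with (i, j) in both X and Y, and there is no K_5.
   For X and its complement the graph is thus a yes-instance; streaming the
   X-edges first, the pair (certificate, memory after the X-edges) must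
   determine X, since otherwise the X-edges followed by the remaining edges for
   the complement of X' would be accepted although they contain a K_4.
   So 2^(k^2) <= 2^(c+1) * 2^m, with k = n / 4. *)
Require Import Defs.
From mathcomp Require Import all_boot all_order all_algebra zify.

Set Implicit Arguments.
Unset Strict Implicit.
Unset Printing Implicit Defensive.

Section Gadget.
Variables (n k : nat) (f : bool * bool * 'I_k -> 'I_n).
Hypothesis f_inj : injective f.

Implicit Types (p q : bool * bool * 'I_k) (Z : bool -> {set 'I_k * 'I_k}).

(* In a vertex ((a, b), i), the bit a tells the w-side from the u-side, and b
   the primed from the unprimed copy. *)
Definition gadget_adj Z p q : bool :=
  let: (a, b, i) := p in let: (a', b', j) := q in
  if a == a' then (b != b') && (i == j)
  else (b != b') || ((if a then (j, i) else (i, j)) \in Z b).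

Lemma gadget_adj_sym Z : symmetric (gadget_adj Z).
Proof.
by move=> [[[] []] i] [[[] []] j] //=; rewrite eq_sym.
Qed.

Lemma gadget_adj_irr Z : irreflexive (gadget_adj Z).
Proof. by move=> [[[] []] i]. Qed.

Definition gadget_edges Z : {set {set 'I_n}} :=
  [set [set f pq.1; f pq.2] | pq in [pred pq | gadget_adj Z pq.1 pq.2]].

Lemma gadget_edges_card2 Z : [forall e in gadget_edges Z, #|e| == 2].
Proof.
apply/forall_inP => _ /imsetP[[p q] /= pq ->].
rewrite cards2 (inj_eq f_inj); case: (eqVneq p q) pq => // ->.
by rewrite inE /= gadget_adj_irr.
Qed.

Definition gadget Z : sgraph n := SGraph (gadget_edges_card2 Z).

Lemma set2_eq (T : finType) (x y u v : T) :
  [set x; y] = [set u; v] -> (x = u /\ y = v) \/ (x = v /\ y = u).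
Proof.
move=> E.
have : x \in [set u; v] by rewrite -E set21.
have : y \in [set u; v] by rewrite -E set22.
have : u \in [set x; y] by rewrite E set21.
have : v \in [set x; y] by rewrite E set22.
by do 4!case/set2P => ?; subst; auto.
Qed.

Lemma gadget_edgeE Z p q :
  ([set f p; f q] \in edges (gadget Z)) = gadget_adj Z p q.
Proof.
apply/imsetP/idP => [[[p' q'] /= pq E]|pq]; last by exists (p, q).
rewrite inE /= in pq.
by case: (set2_eq E) => [] [/f_inj -> /f_inj ->] //; rewrite gadget_adj_sym.
Qed.

(** Vertices outside the image of [f], present when n exceeds 4k, are isolated. *)
Lemma gadget_clique_codom Z (K : {set 'I_n}) :
  clique (gadget Z) K -> 1 < #|K| -> K \subset codom f.
Proof.
move=> /forall_inP clK K2; apply/subsetP => x xK.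
have /card_gt0P[y] : 0 < #|K :\ x| by move: K2; rewrite (cardsD1 x) xK.
rewrite !inE eq_sym => /andP[xy yK].
have /forall_inP/(_ y yK)/implyP/(_ xy)/imsetP[[p q] _ /=] := clK x xK.
by move=> /set2_eq[] [-> _]; exact: codom_f.
Qed.

(** [Z false] and [Z true] are the sets X and Y of the construction. *)
Lemma gadget_clique_number_le3 Z :
  [disjoint Z false & Z true] -> clique_number (gadget Z) <= 3.
Proof.
move=> dZ; apply/bigmax_leqP => K clK; rewrite leqNgt; apply/negP => K4.
have Kf := gadget_clique_codom clK (ltnW (ltnW K4)).
pose K' := f @^-1: K.
have adjK p q : p \in K' -> q \in K' -> p != q -> gadget_adj Z p q.
  rewrite !inE => pK qK pq; rewrite -gadget_edgeE.
  move/forall_inP: clK => /(_ _ pK)/forall_inP/(_ _ qK)/implyP; apply.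
  by rewrite (inj_eq f_inj).
have cardK' : #|K'| = #|K|.
  rewrite -(card_imset _ f_inj); apply: eq_card => y.
  apply/imsetP/idP => [[p + ->]|yK]; first by rewrite inE.
  have /codomP[p def_y] := subsetP Kf y yK.
  by exists p => //; rewrite inE -def_y.
(* Vertices that share [p.1] are never adjacent, so a clique has at most one vertex in each of the
   four classes; with four or more vertices it meets them all. *)
have fst_inj : {in K' &, injective (fun p : bool * bool * 'I_k => p.1)}.
  move=> [[a b] i] [[a' b'] j] pK qK /= E; apply/eqP/negPn/negP => pq.
  by have := adjK _ _ pK qK pq; case: E => <- <-; rewrite /= !eqxx.
have part c : exists i, (c, i) \in K'.
  have : c \in [set p.1 | p in K'].
    suff -> : [set p.1 | p in K'] = setT by [].
    apply/eqP; rewrite eqEcard subsetT card_in_imset // cardK'.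
    by rewrite cardsT card_prod card_bool.
  by case/imsetP => -[c' i] iK' /= ->; exists i.
have [i iK] := part (false, false); have [i' iK'] := part (false, true).
have [j jK] := part (true, false); have [j' jK'] := part (true, true).
(* The two matchings force i = i' and j = j', which puts (i, j) in both sets. *)
have /= /eqP ii := adjK _ _ iK iK' isT.
have /= /eqP jj := adjK _ _ jK jK' isT.
have /= ij := adjK _ _ iK jK isT.
have /= ij' := adjK _ _ iK' jK' isT.
by have := disjointFr dZ ij; rewrite ii jj ij'.
Qed.

Lemma gadget_clique_number_gt3 Z i j :
  (i, j) \in Z false -> (i, j) \in Z true -> 3 < clique_number (gadget Z).
Proof.
move=> ij ij'.
pose h (c : bool * bool) := f (c, if c.1 then j else i).
have h_inj : injective h by move=> c d /f_inj[].
have -> : 4 = #|h @: setT| by rewrite card_imset // cardsT card_prod card_bool.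
apply: (@leq_bigmax_cond _ _ (fun K : {set 'I_n} => #|K|)).
apply/forall_inP => _ /imsetP[c _ ->]; apply/forall_inP => _ /imsetP[d _ ->].
apply/implyP; rewrite gadget_edgeE (inj_eq h_inj).
by case: c d => [[] []] [[] []] //=; rewrite ?eqxx ?ij ?ij'.
Qed.

(** All sets of unprimed vertices, independently of Z. Every gadget edge other than an X-edge has a
    primed endpoint, so this set cuts out exactly the X-edges. *)
Definition left_edges : {set {set 'I_n}} := powerset [set f p | p : _ & ~~ p.1.2].

Lemma left_edgeE p q :
  ([set f p; f q] \in left_edges) = ~~ p.1.2 && ~~ q.1.2.
Proof. by rewrite powersetE subUset !sub1set !mem_imset // !inE. Qed.

Lemma gadget_edges_left Z Z' : Z false = Z' false ->
  edges (gadget Z) :&: left_edges = edges (gadget Z') :&: left_edges.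
Proof.
move=> eZ; apply/setP => e; rewrite !in_setI.
suff sub Y Y' : Y false = Y' false -> e \in left_edges ->
    e \in edges (gadget Y) -> e \in edges (gadget Y').
  by apply/andP/andP => -[eG eL]; split=> //; move: eG; apply: sub.
move=> eY eL /imsetP[[p q] pq def_e]; rewrite inE /= in pq.
move: eL; rewrite def_e left_edgeE gadget_edgeE.
by case: p q pq {def_e} => [[a []] i] [[a' []] j] //=; rewrite -eY.
Qed.

Lemma gadget_edges_right Z Z' : Z true = Z' true ->
  edges (gadget Z) :\: left_edges = edges (gadget Z') :\: left_edges.
Proof.
move=> eZ; apply/setP => e; rewrite !in_setD.
suff sub Y Y' : Y true = Y' true -> e \notin left_edges ->
    e \in edges (gadget Y) -> e \in edges (gadget Y').
  by apply/andP/andP => -[eL eG]; split=> //; move: eG; apply: sub.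
move=> eY eL /imsetP[[p q] pq def_e]; rewrite inE /= in pq.
move: eL; rewrite def_e left_edgeE gadget_edgeE.
by case: p q pq {def_e} => [[a []] i] [[a' []] j] //=; rewrite -eY.
Qed.

End Gadget.

Lemma perm_enum_setID (T : finType) (A B : {set T}) :
  perm_eq (enum (A :&: B) ++ enum (A :\: B)) (enum A).
Proof.
apply: uniq_perm; rewrite ?cat_uniq ?enum_uniq //.
  rewrite andbT; apply/hasPn => x; rewrite !mem_enum !inE.
  by case/andP => /negPf ->; rewrite andbF.
by move=> x; rewrite mem_cat !mem_enum -in_setU setID.
Qed.

(* The leading 1 marks where the padding stops. *)
Definition pad_bits (l : nat) (w : seq bool) : seq bool :=
  nseq (l - size w) false ++ true :: w.

Lemma size_pad_bits l w : size w <= l -> size (pad_bits l w) = l.+1.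
Proof. by move=> wl; rewrite size_cat size_nseq /= addnS subnK. Qed.

Lemma pad_bits_inj l : injective (pad_bits l).
Proof.
move=> w w'; rewrite /pad_bits.
by elim: (l - size w) (l - size w') => [|a IHa] [|b] //= [] => [|/IHa].
Qed.

Lemma certification_scheme_lower_bound (c m : nat -> nat)
    (S : certification_scheme (max_clique_le 3) c m) (n k : nat) :
  4 * k <= n -> k ^ 2 <= c n + m n + 1.
Proof.
move=> kn.
(* The 4k gadget vertices become the first 4k of the n vertices. *)
have le_n : #|{: bool * bool * 'I_k}| <= n.
  by rewrite !card_prod card_bool card_ord.
pose f p := widen_ord le_n (enum_rank p).
have f_inj : injective f.
  by move=> p q /(congr1 val) /= /ord_inj/enum_rank_inj.
pose G (x y : {set 'I_k * 'I_k}) :=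
  gadget f_inj (fun b => if b then ~: y else x).
pose w x := prover S (G x x).
pose V := verif S n.
pose L := left_edges f.
pose st x := foldl (update V (w x)) (init_mem V (w x))
                   (enum (edges (G x x) :&: L)).
have GP x : max_clique_le 3 (G x x).
  by apply: gadget_clique_number_le3; rewrite -setI_eq0 setICr.
(* Padding gives all keys the same length; its marker bit is the 1 in the final bound. *)
have key_size x : size (pad_bits (c n) (w x) ++ st x) == (c n).+1 + m n.
  by rewrite size_cat size_tuple size_pad_bits // prover_size.
have key_inj : injective (fun x => Tuple (key_size x)).
  suff sub x y : w x = w y -> st x = st y -> x \subset y.
    move=> x y [] /eqP; rewrite eqseq_cat ?size_pad_bits ?prover_size //.
    case/andP => /eqP/pad_bits_inj wE /eqP/val_inj stE.
    by apply/eqP; rewrite eqEsubset !sub.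
  (* A pair in x but not in y lies in both sets of [G x y] and creates a K_4 there. *)
  move=> wE stE; apply/subsetP => -[i j] xij; apply/negPn/negP => yij.
  have nP : ~~ max_clique_le 3 (G x y).
    by rewrite -ltnNge; apply: (@gadget_clique_number_gt3 _ _ _ _ _ i j) => //;
      rewrite inE.
  have /negP[] := soundness S (w y) nP (perm_enum_setID _ L).
  have := completeness S (GP y) (perm_enum_setID _ L).
  (* [G x y] has the left edges of [G x x] and the right edges of [G y y]. Under [w y], equal
     memories after the left edges make its run end as the accepting run on [G y y] does. *)
  rewrite /accepts !foldl_cat -/V -/(w y) -/(st y) -stE.
  rewrite (@gadget_edges_right _ _ _ f_inj _ (fun b => if b then ~: y else x)) //.
  rewrite (@gadget_edges_left _ _ _ f_inj _ (fun b => if b then ~: x else x)) //.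
  by rewrite /st wE.
have := leq_card _ key_inj.
rewrite card_tuple card_bool -cardsT -powersetT card_powerset cardsT card_prod.
by rewrite card_ord leq_exp2l // mulnn addSn addn1.
Qed.

(** With k the floor of n/4, n <= 8k gives n^2 <= 64(c + m + 1). As k >= 2 makes c + m positive, the
    1 is absorbed by doubling 64 to 128. *)
Lemma certification_scheme_quadratic (c m : nat -> nat)
    (S : certification_scheme (max_clique_le 3) c m) (n : nat) :
  8 <= n -> n ^ 2 <= 128 * (c n + m n).
Proof.
move=> n8; have kn : 4 * (n %/ 4) <= n by rewrite mulnC leq_divM.
have := certification_scheme_lower_bound S kn.
have k2 : 2 <= n %/ 4 by lia.
have nk : n <= 8 * (n %/ 4) by lia.
by nia.
Qed.

Unset Implicit Arguments.
From mathcomp Require Import all_classical all_reals all_analysis.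
Import Order.TTheory GRing.Theory Num.Theory numFieldNormedType.Exports.
Local Open Scope classical_set_scope.
Local Open Scope ring_scope.

Theorem theorem20 (R : realType) (c m : nat -> nat)
    (S : certification_scheme (max_clique_le 3) c m) :
  (fun n : nat => (c n + m n)%:R : R^o) \is
    'Omega_\oo (fun n : nat => (n ^ 2)%:R : R^o).
Proof.
rewrite qualifE; apply/asboolP; exists 128%:R^-1; first by rewrite invr_gt0.
exists 8%N => // n /= n8.
rewrite !normr_nat ler_pdivrMl ?ltr0n // -natrM ler_nat.
exact: certification_scheme_quadratic S _ n8.
Qed.
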